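(* Let $\tau$ be the Golomb topology on $\mathbb{N}=\{1,2,3,\dots\}$. There exists a countably infinite family of pairwise disjoint subsets of $\mathbb{N}$, each of which is infinite, closed in $(\mathbb{N},\tau)$, and superconnected in the subspace topology inherited from $(\mathbb{N},\tau)$.
   Context: $\mathbb{N}$ is the set of positive integers and $\mathbb{N}_0=\{0\}\cup\mathbb{N}$. The Golomb topology $\tau$ on $\mathbb{N}$ is the topology generated by the base consisting of all arithmetic progressions $a+b\mathbb{N}_0=\{a+bn:n\in\mathbb{N}_0\}$ with $a,b\in\mathbb{N}$ coprime. A topological space $X$ is superconnected if for any $n\in\mathbb{N}$ and any non-empty open sets $U_1,\dots,U_n\subset X$ the intersection of their closures $\overline{U_1}\cap\dots\cap\overline{U_n}$ (closures in $X$) is not empty. *)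

(* Defs.v *)
From HB Require Import structures.
From mathcomp Require Import all_boot all_classical topology.

Set Implicit Arguments.
Unset Strict Implicit.
Unset Printing Implicit Defensive.

Local Open Scope classical_set_scope.

(* The set of positive integers, as a type of its own so that it can carry the
   Golomb topology ([nat] already has a topology in the library). *)
Record golomb := Golomb { golomb_val :> nat; _ : (0 < golomb_val)%N }.

HB.instance Definition _ := [isSub for golomb_val].
HB.instance Definition _ := [Countable of golomb by <:].

(* [a + b * n] ranges over n >= 0, i.e. this is the one-sided progression
   starting at [a]. *)
Definition progression (a b : nat) : set golomb :=
  [set x : golomb | exists n : nat, x = (a + b * n)%N :> nat].

Definition golomb_index : set (nat * nat) :=
  [set ab | [/\ (0 < ab.1)%N, (0 < ab.2)%N & coprime ab.1 ab.2]].

Definition golomb_base (ab : nat * nat) : set golomb :=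
  progression ab.1 ab.2.

Lemma golomb_base_cover :
  \bigcup_(ab in golomb_index) golomb_base ab = [set: golomb].
Proof.
apply/seteqP; split=> // x _; exists (x : nat, 1%N).
  by split=> //=; [exact: (valP x)|exact: coprimen1].
by exists 0%N; rewrite muln0 addn0.
Qed.

Lemma golomb_base_join (i j : nat * nat) (t : golomb) :
  golomb_index i -> golomb_index j -> golomb_base i t -> golomb_base j t ->
  exists k, [/\ golomb_index k, golomb_base k t &
    golomb_base k `<=` golomb_base i `&` golomb_base j].
Proof.
move: i j => [a b] [c d] [/= _ b0 ab] [/= _ d0 cd] [n /= tn] [m /= tm].
exists (t : nat, (b * d)%N); split.
- split=> /=; [exact: (valP t)|by rewrite muln_gt0 b0|].
  have copD u v w : coprime (u + v * w) v = coprime u v.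
    by rewrite addnC mulnC coprime_sym /coprime gcdnMDl gcdnC.
  by rewrite coprimeMr {1}tn copD ab tm copD.
- by exists 0%N; rewrite muln0 addn0.
- move=> x [k /= xk]; split=> /=.
    by exists (n + d * k)%N; rewrite /= xk tn mulnDr mulnA addnA.
  by exists (m + b * k)%N; rewrite /= xk tm mulnDr mulnA (mulnC d b) addnA.
Qed.

HB.instance Definition _ :=
  isBaseTopological.Build golomb golomb_base_cover golomb_base_join.

Lemma golomb_openP (U : set golomb) :
  open U <->
  exists2 D : set (nat * nat), D `<=` golomb_index &
    U = \bigcup_(ab in D) progression ab.1 ab.2.
Proof. by split=> [[D DI <-]|[D DI ->]]; exists D. Qed.

Definition superconnected (X : topologicalType) : Prop :=
  forall (n : nat) (U : 'I_n -> set X), (0 < n)%N ->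
    (forall i, open (U i)) -> (forall i, U i !=set0) ->
    \bigcap_i closure (U i) !=set0.

(* Main.v *)
(* The space [golomb] is itself superconnected: the closure of [a + b * N]
   contains all multiples of [b]. So is any image of it under a continuous map,
   and a map [f] with [f 0 = 0] that sends each progression [x + b * N] into
   [f x + b * N] is continuous: as [x] divides [f x], any modulus coprime to
   [f x] is coprime to [x].

   Sums [f x = \sum_k a_k * x ^_ k] of falling factorials are of this kind, and
   [f k] can be prescribed modulo [p ^ 2] for any prime [p > k], by choosing
   [a_k]. Choose in this way quickly growing primes [q 1 < q 2 < ..] such that
   [f x = q n.+1 %[mod q n.+1 ^ 2]] for [q n <= x < q n.+1]. The sets
   [A_k = {f x ^ k.+1}] are closed, because modulo [q n.+1] the only values of
   [f] are [0] and those at the [x < q n], which are too small to wrap around.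
   They are disjoint, because [k] is read off a value [f x ^ k.+1] as its
   valuation at the prime [q n.+1] attached to [x]. *)
Require Import Defs.
From mathcomp Require Import all_boot all_classical topology.
From mathcomp Require Import zify.

Set Implicit Arguments.
Unset Strict Implicit.
Unset Printing Implicit Defensive.

Local Open Scope classical_set_scope.

(** * Maps compatible with progressions *)

(* As [n] is a natural number, this also makes [f] nondecreasing, hence keeps it
   inside the one-sided progressions of the topology. *)
Definition progressive (f : nat -> nat) : Prop :=
  forall x b, exists n, f (x + b) = f x + b * n.

Lemma progressiveD f g :
  progressive f -> progressive g -> progressive (fun x => f x + g x).
Proof.
move=> pf pg x b; have [n ->] := pf x b; have [m ->] := pg x b.
by exists (n + m); lia.
Qed.

Lemma progressiveM f g :
  progressive f -> progressive g -> progressive (fun x => f x * g x).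
Proof.
move=> pf pg x b; have [n ->] := pf x b; have [m ->] := pg x b.
by exists (f x * m + n * g x + b * n * m); lia.
Qed.

Lemma progressive_cst c : progressive (fun=> c).
Proof. by move=> x b; exists 0; lia. Qed.

Lemma progressiveX f k : progressive f -> progressive (fun x => f x ^ k).
Proof.
move=> pf; elim: k => [|k IH]; first exact: progressive_cst.
move=> x b; have [n e] := progressiveM pf IH x b.
by exists n; rewrite !expnS.
Qed.

Lemma progressive_ffact k : progressive (fun x => x ^_ k).
Proof.
elim: k => [|k IH]; first exact: progressive_cst.
(* At [0] the predecessor is truncated, so the induction hypothesis does not help there. *)
case=> [|x] b; first by exists (b.-1 ^_ k); rewrite !ffactnS add0n mul0n add0n.
have [n e] := IH x b.
exists (x.+1 * n + x ^_ k + b * n); rewrite !ffactnS addSn !succnK e; lia.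
Qed.

Lemma progressive_modn f b x : progressive f -> f x = f (x %% b) %[mod b].
Proof.
move=> pf; have [n] := pf (x %% b) (x %/ b * b).
by rewrite addnC -divn_eq => ->; rewrite mulnAC addnC modnMDl.
Qed.

Lemma dvdn_progressive f x : progressive f -> f 0 = 0 -> x %| f x.
Proof.
by move=> pf f0; have [n] := pf 0 x; rewrite add0n f0 => ->; exact: dvdn_mulr.
Qed.

(** * Prescribing values modulo squares of primes *)

Lemma exists_addn_muln_modn c n L r : coprime c n -> 0 < c -> 0 < n ->
  exists a, L + a * c = r %[mod n].
Proof.
move=> cn c0 n0; have [u cu] := coprimeP _ c0 cn.
have {}cu : u.1 * c = 1 + u.2 * n by lia.
(* [u.1] inverts [c] modulo [n], and [n.-1 * L] acts as [- L]. *)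
exists (u.1 * (r + n.-1 * L)).
have -> : L + u.1 * (r + n.-1 * L) * c = (L + u.2 * (r + n.-1 * L)) * n + r.
  rewrite mulnAC cu; case: n n0 {cn cu} => // n _; rewrite succnK; lia.
by rewrite modnMDl.
Qed.

(** Adding a multiple of [x ^_ m] changes nothing below [m]; at [m] the coefficient is multiplied by
    the factorial of [m], invertible modulo [p ^ 2] as [m < p]. *)
Lemma adjust_value F p m : progressive F -> prime p -> m < p ->
  exists G, [/\ progressive G, forall x, x < m -> G x = F x &
    G m = p %[mod p ^ 2]].
Proof.
move=> pF pp mp.
have cp : coprime m`! (p ^ 2).
  rewrite coprimeXr // coprime_sym prime_coprime //.
  elim: m mp => [|m IH] mp; first by rewrite fact0 dvdn1; case: p pp mp => [|[]].
  by rewrite factS Euclid_dvdM // negb_or IH ?andbT ?gtnNdvd // ltnW.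
have p0 : 0 < p ^ 2 by rewrite expn_gt0 prime_gt0.
have [a ae] := exists_addn_muln_modn (F m) p cp (fact_gt0 m) p0.
exists (fun x => F x + a * x ^_ m); split.
- apply: progressiveD => //; apply: progressiveM; first exact: progressive_cst.
  exact: progressive_ffact.
- by move=> x xm; rewrite ffact_small // muln0 addn0.
- by rewrite ffactnn.
Qed.

Lemma adjust_values F p q m : progressive F -> prime p -> m <= p ->
  exists G, [/\ progressive G, forall x, x < q -> G x = F x &
    forall x, q <= x < m -> G x = p %[mod p ^ 2]].
Proof.
move=> pF pp; elim: m => [|m IH] mp; first by exists F; split => // x; lia.
have [G [pG GF Gp]] := IH (ltnW mp).
have [mq|qm] := ltnP m q; first by exists G; split => // x ?; lia.
have [H [pH HG Hm]] := adjust_value pG pp mp.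
exists H; split => // [x xq|x /andP[qx]]; first by rewrite HG ?GF //; lia.
rewrite ltnS leq_eqVlt => /orP[/eqP->//|xm].
by rewrite HG // Gp // qx.
Qed.

(** * Recursive construction of the function and the primes *)

(** In a stage [(q, F)] only the values of [F] below [q] are final. *)
Definition extends (s t : nat * (nat -> nat)) : Prop :=
  [/\ prime t.1, s.1 < t.1, forall x, x < s.1 -> s.2 x ^ s.1 < t.1,
    forall x, x < s.1 -> t.2 x = s.2 x &
    forall x, s.1 <= x < t.1 -> t.2 x = t.1 %[mod t.1 ^ 2]].

Lemma exists_extends s : progressive s.2 ->
  exists2 t, progressive t.2 & extends s t.
Proof.
case: s => q F /= pF.
have [p bp pp] := prime_above (q + \max_(x < q) F x ^ q).
have [G [pG GF Gp]] := adjust_values q pF pp (leqnn p).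
exists (p, G) => //; split=> //=; first by lia.
move=> x xq; have /= := @leq_bigmax 'I_q (fun i => F i ^ q) (Ordinal xq) => h.
by apply: leq_ltn_trans h (leq_ltn_trans (leq_addl _ _) bp).
Qed.

(* The bound on [f x ^ q n] serves all the powers of [f] at once: the exponent
   [k.+1] is covered by every [n] with [k < q n]. *)
Definition layered (f q : nat -> nat) : Prop :=
  [/\ progressive f, f 0 = 0, q 0 = 1 &
    forall n, [/\ prime (q n.+1), q n < q n.+1,
      forall x, x < q n -> f x ^ q n < q n.+1 &
      forall x, q n <= x < q n.+1 -> f x = q n.+1 %[mod q n.+1 ^ 2]]].

Lemma exists_layered : exists f q, layered f q.
Proof.
have /choice[step stepP] : forall s, exists t,
    progressive s.2 -> progressive t.2 /\ extends s t.
  move=> s; have [/exists_extends[t pt st]|ns] := pselect (progressive s.2).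
    by exists t.
  by exists s.
(* The initial bound [1] freezes the value [0] at [0]. *)
pose s n := iter n step (1, fun=> 0).
have ps n : progressive (s n).2.
  by elim: n => [|n /stepP[]//]; exact: progressive_cst.
have es n : extends (s n) (s n.+1) by have [] := stepP _ (ps n).
have ltq n : n < (s n).1 by elim: n => // n IH; have [] := es n; lia.
have keep n k x : x < (s n).1 -> (s (k + n)).2 x = (s n).2 x.
  move=> xn; have xk j : x < (s (j + n)).1.
    by elim: j => // j IH; have [] := es (j + n); rewrite addSn; lia.
  by elim: k => // k IH; have [_ _ _ + _] := es (k + n); rewrite addSn => ->.
have sf n x : x < (s n).1 -> (s n).2 x = (s x).2 x.
  move=> xn; rewrite -(keep n x x xn) addnC keep //.
(* The value at [x] is final from stage [x] on, so the values at [x] and [x + b] can both be read at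
   stage [x + b]. *)
exists (fun x => (s x).2 x), (fun n => (s n).1); split=> //.
- move=> x b; rewrite -(sf (x + b) x); first exact: ps.
  by have := ltq (x + b); lia.
- move=> n; have [pn qn bn _ cn] := es n; split=> // x xn.
    by rewrite -(sf n) // bn.
  by rewrite -(sf n.+1) ?cn //; case/andP: xn.
Qed.

(** * Blocks, valuations and separation *)

Lemma layered_gt f q n : layered f q -> n < q n.
Proof.
by case=> _ _ q0 h; elim: n => [|n IH]; [rewrite q0|have [] := h n; lia].
Qed.

Lemma layered_block f q x : layered f q -> 0 < x -> exists n, q n <= x < q n.+1.
Proof.
move=> L x0; have ex : exists n, x < q n by exists x; exact: layered_gt L.
case: (ex_minnP ex) => -[|n] xn nmin; first by case: L xn => _ _ ->; lia.
by exists n; rewrite xn andbT leqNgt; apply/negP => /nmin; rewrite ltnn.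
Qed.

Lemma layered_logn f q n x : layered f q -> q n <= x < q n.+1 ->
  0 < f x /\ logn (q n.+1) (f x) = 1.
Proof.
case=> _ _ _ /(_ n)[pp _ _ h] /h{h}; set p := q n.+1 in pp *.
have p1 := prime_gt1 pp.
have pp2 : p %% p ^ 2 = p by rewrite modn_small // expnS expn1 ltn_Pmulr; lia.
rewrite pp2 => fx; have f0 : 0 < f x.
  by rewrite lt0n; apply/eqP => f0; rewrite f0 mod0n in fx; lia.
have p2f : ~~ (p ^ 2 %| f x) by rewrite /dvdn fx -lt0n; exact: ltnW.
have pf : p ^ 1 %| f x.
  by rewrite (divn_eq (f x) (p ^ 2)) fx dvdn_addl // dvdn_mull // dvdn_exp2l.
by split=> //; move: p2f pf; rewrite !pfactor_dvdn //; lia.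
Qed.

Lemma layered_gt0 f q x : layered f q -> 0 < x -> 0 < f x.
Proof. by move=> L /(layered_block L)[n] /(layered_logn L)[]. Qed.

Lemma layered_dvdn f q n x : layered f q -> q n <= x < q n.+1 -> q n.+1 %| f x.
Proof.
move=> L xn; have [_ _ _ /(_ n)[pp _ _ _]] := L.
by have [f0 e] := layered_logn L xn; rewrite -(expn1 (q _)) pfactor_dvdn // e.
Qed.

Lemma layered_powers_disjoint f q i j x y : layered f q -> 0 < x -> 0 < y ->
  f x ^ i.+1 = f y ^ j.+1 -> i = j.
Proof.
move=> L; wlog: i j x y / x <= y.
  move=> W x0 y0 e; have [xy|/ltnW yx] := leqP x y; first exact: (W i j x y).
  exact/esym/(W j i y x).
move=> xy x0 y0 e; have [n yn] := layered_block L y0.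
have [_ _ _ /(_ n)[pp _ bn _]] := L.
(* For [x] in an earlier block, [f x] is positive and below [q n.+1], so not divisible by it. *)
have [xn|nx] := ltnP x (q n).
  have /dvdn_leq : q n.+1 %| f x.
    suff : q n.+1 %| f x ^ i.+1 by rewrite Euclid_dvdX // => /andP[].
    by rewrite e dvdn_exp // (layered_dvdn L yn).
  move=> /(_ (layered_gt0 L x0)); have := bn x xn.
  have : f x <= f x ^ q n.
    by rewrite -[leqLHS]expn1 leq_pexp2l ?(layered_gt0 L) //; lia.
  lia.
have xn : q n <= x < q n.+1 by lia.
have := congr1 (logn (q n.+1)) e.
rewrite !lognX (layered_logn L xn).2 (layered_logn L yn).2; lia.
Qed.

Lemma layered_leq_id f q x : layered f q -> x <= f x.
Proof.
move=> L; have [->//|x0] := posnP x.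
apply: dvdn_leq; first exact: layered_gt0 L _.
by case: L => pf f0 _ _; exact: dvdn_progressive.
Qed.

Lemma layered_separation f q k y : layered f q -> 0 < y ->
  (forall x, 0 < x -> f x ^ k.+1 <> y) ->
  exists b, [/\ 0 < b, coprime y b & forall x, f x ^ k.+1 <> y %[mod b]].
Proof.
(* This index makes [q n] exceed both [y] and [k]: the modulus [q n.+1] is then above [y], and the
   bound on [f x ^ q n] covers the exponent [k.+1]. *)
move=> L y0 ny; pose n := y + k; have [pf f0 _ /(_ n)[pp qlt bn _]] := L.
have nq := layered_gt n L.
have yb : y < q n.+1 by lia.
exists (q n.+1); split; first by lia.
  rewrite coprime_sym prime_coprime //; apply/negP => /(dvdn_leq y0); lia.
move=> x; rewrite (progressive_modn _ _ (progressiveX k.+1 pf)).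
set r := x %% _; have rb : r < q n.+1 by rewrite ltn_mod; lia.
rewrite (modn_small yb) => e.
have [r0|r0] := posnP r; first by move: e; rewrite r0 f0 exp0n // mod0n; lia.
have [rq|qr] := ltnP r (q n); last first.
  have : q n.+1 %| f r ^ k.+1 by rewrite dvdn_exp // (layered_dvdn L) // qr.
  by move/eqP; lia.
apply: (ny r r0); rewrite -e modn_small //.
apply: leq_ltn_trans (bn r rq); rewrite leq_pexp2l ?(layered_gt0 L) //; lia.
Qed.

(** * Neighbourhoods and superconnectedness *)

(** A basic progression through [x] may be restarted at [x]: coprimality to the step depends only on
    the residue. *)
Lemma golomb_nbhsP (x : golomb) (B : set golomb) :
  nbhs x B <-> exists b, [/\ 0 < b, coprime x b & progression x b `<=` B].
Proof.
split=> [|[b [b0 xb sB]]].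
  rewrite nbhsE => -[U [/golomb_openP[D DI ->] [[a b] /= Dab [n xn]] sB]].
  have [/= a0 b0 ab] := DI _ Dab; exists b; split=> //.
    by rewrite xn -coprime_modl addnC mulnC modnMDl coprime_modl.
  move=> y [m ym]; apply: sB; exists (a, b) => //; exists (n + m).
  by rewrite /= ym xn; lia.
rewrite nbhsE; exists (progression x b) => //; split; last by exists 0; lia.
apply/golomb_openP; exists [set (golomb_val x, b)]; last by rewrite bigcup_set1.
by move=> _ ->; split=> //; exact: (valP x).
Qed.

Lemma superconnected_golomb : superconnected golomb.
Proof.
move=> n U _ oU U0.
have /choice[a aP] : forall i, exists a : golomb * nat,
    0 < a.2 /\ progression a.1 a.2 `<=` U i.
  move=> i; have [x Ux] := U0 i.
  have /golomb_nbhsP[b [b0 _ sb]] : nbhs x (U i) by exact: open_nbhs_nbhs.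
  by exists (x, b).
have prod0 : 0 < \prod_i (a i).2 by apply: prodn_gt0 => i; have [] := aP i.
(* A modulus [d] coprime to the product of the steps is coprime to each step, so the Chinese
   remainder theorem applies. *)
exists (Golomb prod0) => i _ B /golomb_nbhsP[d [d0 /= cd sB]].
have [b0 sU] := aP i.
have cbd : coprime (a i).2 d.
  by move: cd; rewrite (bigD1 i) //= coprimeMl => /andP[].
set x := \prod_i _ in prod0 cd sB.
have [m me] := exists_addn_muln_modn (a i).1 x cbd b0 d0.
(* The term [d * x] keeps the residue modulo [d] and ensures [x <= z], as progressions are
   one-sided. *)
pose z := (a i).1 + (a i).2 * (m + d * x).
have z0 : 0 < z by rewrite addn_gt0 (valP (a i).1).
have zx : x <= z.
  rewrite /z mulnDr addnA; apply: (leq_trans _ (leq_addl _ _)).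
  by rewrite mulnA leq_pmull // muln_gt0 b0.
have zd : z = x %[mod d].
  by rewrite -me /z mulnDr addnA mulnCA (mulnC d) addnC modnMDl (mulnC m).
exists (Golomb z0); split; first by apply: sU; exists (m + d * x).
apply: sB; exists ((z - x) %/ d) => /=.
have /dvdnP[k kz] : d %| z - x by rewrite -eqn_mod_dvd // zd.
by rewrite kz mulnK // mulnC -kz subnKC.
Qed.

(** Open sets of the range pull back to [X], and a common closure point found there is mapped to one
    in the range. *)
Lemma superconnected_range (X Y : topologicalType) (h : X -> Y) :
  continuous h -> superconnected X -> superconnected (set_type (range h)).
Proof.
move=> hc sX n U n0 oU U0.
pose k x : set_type (range h) := SigSub (mem_set (imageT h x)).
have kc (W : set (set_type (range h))) : open W -> open (k @^-1` W).
  by case=> V oV <-; exact: (proj1 (continuousP h) hc).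
have [|i|x xU] := sX n (fun i => k @^-1` U i) n0; first by move=> i; exact: kc.
- have [y Uy] := U0 i; have /set_mem[x _ xy] := valP y.
  by exists x; rewrite /preimage /=; suff -> : k x = y by []; exact: val_inj.
exists (k x) => i _ B; rewrite nbhsE => -[V [oV Vx] VB].
have [|z [Uz Vz]] := xU i I (k @^-1` V).
  by apply: open_nbhs_nbhs; split=> //; exact: kc.
by exists (k z); split=> //; exact: VB.
Qed.

(** * Continuous self-maps and their ranges *)

(** The default [x] is taken only where [g x] is [0]. *)
Definition golomb_map (g : nat -> nat) (x : golomb) : golomb := insubd x (g x).

Lemma golomb_mapE (g : nat -> nat) (x : golomb) :
  0 < g x -> golomb_map g x = g x :> nat.
Proof. by move=> g0; rewrite /golomb_map val_insubd g0. Qed.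

Lemma continuous_golomb_map g : progressive g -> g 0 = 0 ->
  (forall x, 0 < x -> 0 < g x) -> continuous (golomb_map g).
Proof.
move=> pg g0 gp x B /golomb_nbhsP[b [b0 + sB]].
have x0 := valP x; rewrite golomb_mapE ?gp // => cb.
apply/golomb_nbhsP; exists b; split=> //.
  exact: coprime_dvdl (dvdn_progressive _ pg g0) cb.
move=> y [n yn]; apply: sB; have [m gm] := pg x (b * n).
exists (n * m); rewrite !golomb_mapE ?gp ?(valP y) // yn gm mulnA //.
Qed.

Theorem corollary4p5 :
  exists F : set (set golomb),
    [/\ (F #= [set: nat])%card,
        trivIset F id &
        forall A : set golomb, F A ->
          [/\ infinite_set A, closed A & superconnected (set_type A)]].
Proof.
have [f [q L]] := exists_layered; have [pf f0 _ _] := L.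
pose g k x := f x ^ k.+1.
have g0 k x : 0 < x -> 0 < g k x by move=> x0; rewrite expn_gt0 (layered_gt0 L).
have gE k (x : golomb) : golomb_map (g k) x = f x ^ k.+1 :> nat.
  by rewrite golomb_mapE ?g0 // (valP x).
pose A k := range (golomb_map (g k)).
have A_disj i j : A i `&` A j !=set0 -> i = j.
  move=> [y [[x _ <-] [z _ /(congr1 golomb_val)]]]; rewrite !gE => /esym.
  by apply: layered_powers_disjoint L _ _; [exact: valP x|exact: valP z].
(* This point shows that each [A j] is nonempty, so that disjointness yields injectivity. *)
pose one : golomb := Golomb (ltn0Sn 0).
have A_inj : injective A.
  move=> i j ij; apply: A_disj; rewrite ij setIid.
  by exists (golomb_map (g j) one), one.
exists (range A); split.
- by apply: inj_card_eq => i j _ _; exact: A_inj.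
- by move=> _ _ [i _ <-] [j _ <-] /A_disj->.
move=> _ [k _ <-]; split.
(* The value at [M.+1] is at least [M.+1], above the maximum of a finite list. *)
- move=> /finite_seqP[s As]; pose M := \max_(y <- s) golomb_val y.
  have : A k (golomb_map (g k) (Golomb (ltn0Sn M))).
    by exists (Golomb (ltn0Sn M)).
  rewrite As /= => sM.
  have := leq_bigmax_seq (P := predT) (F := golomb_val) _ sM isT.
  apply/negP.
  rewrite gE -ltnNge; apply: (leq_trans (layered_leq_id M.+1 L)).
  by rewrite -[leqLHS]expn1 leq_pexp2l ?(layered_gt0 L).
- rewrite -[A k]setCK; apply: open_closedC; rewrite openE => y nAy.
  have [||b [b0 cb nb]] := layered_separation (k := k) (y := y) L.
  + exact: valP y.
  + move=> x x0 e; apply: nAy; exists (Golomb x0) => //.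
    by apply: val_inj; rewrite /= gE.
  apply: (golomb_nbhsP _ _).2; exists b; split=> // z [n zn] [x _ xz].
  have e : f x ^ k.+1 = y + b * n by rewrite -zn -xz gE.
  by apply: (nb x); rewrite e addnC mulnC modnMDl.
- apply: superconnected_range superconnected_golomb.
  apply: continuous_golomb_map; [exact: progressiveX| |exact: g0].
  by rewrite /g f0 exp0n.
Qed.
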